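(* Let $\Lambda_0\subset\mathbf{C}$ be a cocompact lattice. There is a free action of a non-abelian free group on the complex torus $(\mathbf{C}/\Lambda_0)^3$ by holomorphic affine transformations.
   Context: An action of a group on a set is free if every point has trivial stabilizer. A holomorphic affine transformation of $(\mathbf{C}/\Lambda_0)^3=\mathbf{C}^3/\Lambda_0^3$ is a holomorphic diffeomorphism induced by an affine map $z\mapsto Lz+T$ of $\mathbf{C}^3$, with $L\in \mathrm{GL}_3(\mathbf{C})$ preserving the lattice $\Lambda_0^3$ and $T\in\mathbf{C}^3$. *)

(* Defs.v *)
From HB Require Import structures.
From mathcomp Require Import all_boot all_order all_algebra ring_quotient complex.
From mathcomp Require Import all_classical all_reals all_analysis.

Set Implicit Arguments.
Unset Strict Implicit.
Unset Printing Implicit Defensive.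

Import GRing.Theory Num.Theory.
Import numFieldNormedType.Exports.

Local Open Scope classical_set_scope.
Local Open Scope ring_scope.

(* The explicit type [numClosedFieldType] is what lets the norm and topology
   instances of MathComp-Analysis, keyed on abstract numFieldTypes, be found;
   on matrices over [CC R] they make [differentiable] mean complex
   differentiability. *)
Definition CC (R : realType) : numClosedFieldType := R[i].

(* Discrete subgroup of C whose quotient C / Lambda is compact. *)
Definition cocompact_lattice (R : realType) (Lambda : zmodClosed (CC R)) : Prop :=
  [set` Lambda] `<=` isolated [set` Lambda]
  /\ compact [set: quotient_topology (Quotient.quot Lambda)].

(* (C / Lambda)^n, as column vectors. *)
Definition torus (R : realType) (Lambda : zmodClosed (CC R)) (n : nat) : Type :=
  'cV[Quotient.quot Lambda]_n.

Definition torus_proj (R : realType) (Lambda : zmodClosed (CC R)) (n : nat)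
    (z : 'cV[CC R]_n) : torus Lambda n :=
  map_mx (\pi_(Quotient.quot Lambda))%qT z.

Definition lattice_pow (R : realType) (Lambda : zmodClosed (CC R)) (n : nat) :
    set 'cV[CC R]_n :=
  [set z | forall i, z i 0 \in Lambda].

Arguments lattice_pow {R} Lambda n.

(* The charts of the torus are the local inverses of the covering
   [torus_proj Lambda n], so a map is holomorphic iff it lifts, near each
   point of C^n, to a holomorphic map into C^n. *)
Definition torus_holomorphic (R : realType) (Lambda : zmodClosed (CC R)) (n : nat)
    (f : torus Lambda n -> torus Lambda n) : Prop :=
  forall z : 'cV[CC R]_n, exists F : 'cV[CC R]_n -> 'cV[CC R]_n,
    \forall w \near z,
      f (torus_proj Lambda w) = torus_proj Lambda (F w) /\ differentiable F w.

Definition torus_hol_diffeo (R : realType) (Lambda : zmodClosed (CC R)) (n : nat)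
    (f : torus Lambda n -> torus Lambda n) : Prop :=
  torus_holomorphic f /\
  exists g : torus Lambda n -> torus Lambda n,
    [/\ cancel f g, cancel g f & torus_holomorphic g].

Definition hol_affine_transformation (R : realType) (Lambda : zmodClosed (CC R))
    (n : nat) (f : torus Lambda n -> torus Lambda n) : Prop :=
  torus_hol_diffeo f /\
  exists (L : 'M[CC R]_n) (T : 'cV[CC R]_n),
    [/\ L \in unitmx,
        [set L *m z | z in lattice_pow Lambda n] = lattice_pow Lambda n
      & forall z, f (torus_proj Lambda z) = torus_proj Lambda (L *m z + T)].

Definition is_free_group (G : groupType) : Prop :=
  exists (S : Type) (iota : S -> G),
    forall (H : groupType) (h : S -> H),
      exists! phi : G -> H, monoid.monoid_morphism phi /\ (forall s, phi (iota s) = h s).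

Definition is_group_action (G : groupType) (X : Type) (act : G -> X -> X) : Prop :=
  (forall x, act 1%g x = x) /\
  (forall g h x, act (g * h)%g x = act g (act h x)).

Definition is_free_action (G : groupType) (X : Type) (act : G -> X -> X) : Prop :=
  forall x g, act g x = x -> g = 1%g.

(* Main.v *)
(* SL_2 acts linearly on sl_2 = C^3 by conjugation, and every g fixes the linear
   form X |-> tr (g X).  A first-order deformation of a representation of a
   group into SL_2(Z), that is, a homomorphism g |-> M + eps N into
   SL_2(Z[eps]) with eps^2 = 0, yields the affine action
   X |-> M X M^-1 + tau N M^-1 on (C / Lambda0)^3, and applying tr (M _) to a
   fixed point of g gives tau tr N \in Lambda0.  If no nonzero multiple of tau
   lies in Lambda0, the action is therefore free as soon as tr N <> 0 for every
   g <> 1.  Such a tau exists: if nonzero multiples of both 1 and sqrt 2 were in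
   Lambda0, so would be a nonzero multiple of (sqrt 2 - 1)^i for all i,
   contradicting discreteness.

   For the deformation, take S = [[0, -1], [1, 0]] and
   U = [[0, 1], [-1, -1]] + eps [[1, 0], [-1, -1]], generators of a deformation
   of PSL_2(Z) = Z/2 * Z/3.  Up to sign, S U and S U^-1 are
   [[1, 1], [0, 1]] + eps [[1, 1], [1, 0]] and
   [[1, 0], [1, 1]] + eps [[1, 1], [1, 0]], so in a positive word in S U and
   S U^-1 all entries of M and N have the same sign, and tr N <> 0.  In the
   commutator subgroup, which is free on S U S U^-1 and S U^-1 S U, every
   nontrivial element is conjugate to such a positive word. *)
From HB Require Import structures.
Require Import Defs.
From mathcomp Require Import all_boot all_order all_algebra.
From mathcomp Require Import all_classical all_reals all_analysis.
From mathcomp Require Import ring_quotient complex ring zify lra.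

Set Implicit Arguments.
Unset Strict Implicit.
Unset Printing Implicit Defensive.

Import Order.TTheory GRing.Theory Num.Theory.
Import numFieldNormedType.Exports.

(** * Free groups as reduced words *)

Definition letter (T : Type) : Type := (T * bool)%type.
Definition letter_inv (T : Type) (x : letter T) : letter T := (x.1, ~~ x.2).

Lemma letter_invK (T : Type) : involutive (@letter_inv T).
Proof. by case=> t b; rewrite /letter_inv /= negbK. Qed.

Section FreeGroup.
Variable T : choiceType.
Local Notation letter := (letter T).
Implicit Types (x y : letter) (u v w : seq letter).

Definition reduced w := sorted (fun x y => y != letter_inv x) w.

Definition push x w :=
  if w is y :: w' then if y == letter_inv x then w' else x :: w else [:: x].

Lemma push_reduced x w : reduced w -> reduced (push x w).
Proof.
case: w => [//|y w] /= Hw; case: eqVneq => [_|ne]; first exact: path_sorted Hw.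
by rewrite /= ne.
Qed.

Lemma push_cons x w : reduced (x :: w) -> push x w = x :: w.
Proof. by case: w => [//|y w] /= /andP[/negbTE->]. Qed.

Lemma pushK x w : reduced w -> push (letter_inv x) (push x w) = w.
Proof.
case: w => [_|y w Hw] /=; first by rewrite letter_invK eqxx.
by case: eqVneq => [<-|ne] /=; [exact: push_cons | rewrite letter_invK eqxx].
Qed.

Lemma pushVK x w : reduced w -> push x (push (letter_inv x) w) = w.
Proof. by move=> Hw; rewrite -{1}[x]letter_invK pushK. Qed.

(** Van der Waerden's device: each letter permutes the reduced words through [push], and the inverse
    letter undoes it. Associativity is then composition of these permutations, with no confluence
    argument. *)
Definition word_mul u v := foldr push v u.
Definition word_inv u := rev (map (@letter_inv T) u).

Lemma word_mul_reduced u v : reduced v -> reduced (word_mul u v).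
Proof. by move=> Hv; elim: u => //= x u; apply: push_reduced. Qed.

Lemma word_inv_reduced u : reduced u -> reduced (word_inv u).
Proof.
rewrite /reduced /word_inv rev_sorted sorted_map; apply: sub_sorted => x y /=.
by rewrite letter_invK eq_sym.
Qed.

Lemma word_mul_push x u v :
  reduced v -> word_mul (push x u) v = push x (word_mul u v).
Proof.
move=> Hv; case: u => [//|y u] /=; case: eqVneq => [->|//].
by rewrite pushVK // word_mul_reduced.
Qed.

Lemma word_mulA u v w :
  reduced w -> word_mul (word_mul u v) w = word_mul u (word_mul v w).
Proof.
by move=> Hw; elim: u => //= x u IHu; rewrite word_mul_push // IHu.
Qed.

Lemma word_mul1 u : reduced u -> word_mul u [::] = u.
Proof.
elim: u => //= x u IHu Hxu; rewrite IHu ?push_cons //; exact: path_sorted Hxu.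
Qed.

Lemma word_mulV u v : reduced v -> word_mul (word_inv u) (word_mul u v) = v.
Proof.
elim: u v => [//|x u IHu] v Hv /=.
rewrite /word_inv /= rev_cons /word_mul foldr_rcons pushK ?word_mul_reduced //.
exact: IHu.
Qed.

Lemma word_invK : involutive word_inv.
Proof.
by move=> u; rewrite /word_inv map_rev revK (mapK (@letter_invK T)).
Qed.

Record free_group := FreeGroup { fg_word :> seq letter; _ : reduced fg_word }.

HB.instance Definition _ := [isSub for fg_word].
HB.instance Definition _ := [Choice of free_group by <:].

Lemma fg_reduced (g : free_group) : reduced g.
Proof. by case: g. Qed.

Definition fg_one : free_group := @FreeGroup [::] isT.
Definition fg_mul (g h : free_group) : free_group :=
  FreeGroup (word_mul_reduced g (fg_reduced h)).
Definition fg_inv (g : free_group) : free_group :=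
  FreeGroup (word_inv_reduced (fg_reduced g)).

Lemma fg_mulA : associative fg_mul.
Proof. by move=> g h k; apply: val_inj; rewrite /= word_mulA ?fg_reduced. Qed.
Lemma fg_mul1 : left_id fg_one fg_mul.
Proof. by move=> g; apply: val_inj. Qed.
Lemma fg_mulr1 : right_id fg_one fg_mul.
Proof. by move=> g; apply: val_inj; rewrite /= word_mul1 ?fg_reduced. Qed.
Lemma fg_mulV : left_inverse fg_one fg_inv fg_mul.
Proof.
move=> g; apply: val_inj => /=; rewrite -[X in _ = X](@word_mulV g [::]) //.
by rewrite word_mul1 ?fg_reduced.
Qed.
Lemma fg_mulrV : right_inverse fg_one fg_inv fg_mul.
Proof.
move=> g; apply: val_inj => /=.
rewrite -[X in _ = X](@word_mulV (word_inv g) [::]) // word_invK word_mul1 //.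
exact: fg_reduced (fg_inv g).
Qed.

HB.instance Definition _ := isGroup.Build free_group
  fg_mulA fg_mul1 fg_mulr1 fg_mulV fg_mulrV.

Definition fg_gen (t : T) : free_group := @FreeGroup [:: (t, true)] isT.

Section Lift.
Variables (H : groupType) (h : T -> H).
Local Open Scope group_scope.

Definition letter_val x : H := if x.2 then h x.1 else (h x.1)^-1.
Definition fg_lift (g : free_group) : H := \prod_(x <- fg_word g) letter_val x.

Lemma letter_valV x : letter_val (letter_inv x) = (letter_val x)^-1.
Proof. by case: x => t [] //=; rewrite /letter_val /= invgK. Qed.

Lemma prod_push x w :
  \prod_(y <- push x w) letter_val y =
  letter_val x * \prod_(y <- w) letter_val y.
Proof.
case: w => [|y w] /=; first by rewrite big_cons.
by case: eqVneq => [->|_]; rewrite !big_cons // letter_valV mulVKg.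
Qed.

Lemma fg_lift_morphism : monoid.monoid_morphism fg_lift.
Proof.
split=> [|g k]; first by rewrite /fg_lift big_nil.
rewrite /fg_lift /=; elim: (fg_word g) => [|x u IHu] /=.
  by rewrite big_nil mul1g.
by rewrite prod_push IHu big_cons mulgA.
Qed.

Lemma fg_lift_gen t : fg_lift (fg_gen t) = h t.
Proof. by rewrite /fg_lift big_seq1. Qed.

End Lift.

Lemma fg_morphism_inj (H : groupType) (phi psi : free_group -> H) :
  monoid.monoid_morphism phi -> monoid.monoid_morphism psi ->
  (forall t, phi (fg_gen t) = psi (fg_gen t)) -> phi =1 psi.
Proof.
move=> [phi1 phiM] [psi1 psiM] gen [u Hu].
have phiV (f : free_group -> H) : f 1%g = 1%g -> {morph f : x y / (x * y)%g} ->
    forall g, f g^-1%g = (f g)^-1%g.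
  by move=> f1 fM g; apply: (mulgI (f g)); rewrite -fM !mulgV.
elim: u Hu => [|[t b] u IHu] Hu.
  have -> : FreeGroup Hu = 1%g by apply: val_inj.
  by rewrite phi1 psi1.
have Hu' : reduced u := path_sorted Hu.
have Ex : @FreeGroup [:: (t, b)] isT = if b then fg_gen t else (fg_gen t)^-1%g.
  by case: b Hu => _; apply: val_inj.
have -> : FreeGroup Hu = (@FreeGroup [:: (t, b)] isT * FreeGroup Hu')%g.
  by apply: val_inj; rewrite /= [RHS](push_cons Hu).
by rewrite phiM psiM IHu Ex; case: b {Hu Ex}; rewrite ?phiV // gen.
Qed.

End FreeGroup.

Lemma free_group_is_free (T : choiceType) : is_free_group (free_group T).
Proof.
exists T, (@fg_gen T) => H h; exists (fg_lift h); split.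
  by split; [exact: fg_lift_morphism | exact: fg_lift_gen].
move=> phi [phiM phigen]; apply/funext => g; apply: fg_morphism_inj => // [|t].
- exact: fg_lift_morphism.
- by rewrite fg_lift_gen phigen.
Qed.

Local Open Scope ring_scope.
Local Open Scope classical_set_scope.

(** * A free subgroup of SL_2(Z[eps]) *)

(* The matrix [[e11, e12], [e21, e22]] + eps [[d11, d12], [d21, d22]] over the
   dual numbers Z[eps], eps^2 = 0. *)
Record dmx := DMx { e11 : int; e12 : int; e21 : int; e22 : int;
                    d11 : int; d12 : int; d21 : int; d22 : int }.

Definition dmx_mul (m n : dmx) : dmx :=
  let: DMx a b c d a' b' c' d' := m in
  let: DMx p q r s p' q' r' s' := n in
  DMx (a * p + b * r) (a * q + b * s) (c * p + d * r) (c * q + d * s)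
      (a * p' + b * r' + a' * p + b' * r) (a * q' + b * s' + a' * q + b' * s)
      (c * p' + d * r' + c' * p + d' * r) (c * q' + d * s' + c' * q + d' * s).

Definition dmx_one := DMx 1 0 0 1 0 0 0 0.

Definition dmx_adj (m : dmx) : dmx :=
  let: DMx a b c d a' b' c' d' := m in
  DMx d (- b) (- c) a d' (- b') (- c') a'.

Definition dmx_opp (m : dmx) : dmx :=
  let: DMx a b c d a' b' c' d' := m in
  DMx (- a) (- b) (- c) (- d) (- a') (- b') (- c') (- d').

(** The determinant over Z[eps] is [dmx_det] + eps [dmx_ddet]; [dmx_dtr] is the eps part of the
    trace. *)
Definition dmx_det (m : dmx) : int := e11 m * e22 m - e12 m * e21 m.
Definition dmx_ddet (m : dmx) : int :=
  e11 m * d22 m + d11 m * e22 m - e12 m * d21 m - d12 m * e21 m.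
Definition dmx_dtr (m : dmx) : int := d11 m + d22 m.

Lemma dmx_mulA : associative dmx_mul.
Proof. by do 3 case=> ? ? ? ? ? ? ? ?; congr DMx => /=; ring. Qed.

Lemma dmx_mul1 : left_id dmx_one dmx_mul.
Proof. by case=> ? ? ? ? ? ? ? ?; congr DMx => /=; ring. Qed.

Lemma dmx_mulr1 : right_id dmx_one dmx_mul.
Proof. by case=> ? ? ? ? ? ? ? ?; congr DMx => /=; ring. Qed.

Lemma dmx_dtrC m n : dmx_dtr (dmx_mul m n) = dmx_dtr (dmx_mul n m).
Proof.
by case: m n => ? ? ? ? ? ? ? ? [? ? ? ? ? ? ? ?]; rewrite /dmx_dtr /=; ring.
Qed.

Lemma dmx_detM m n : dmx_det (dmx_mul m n) = dmx_det m * dmx_det n.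
Proof.
by case: m n => ? ? ? ? ? ? ? ? [? ? ? ? ? ? ? ?]; rewrite /dmx_det /=; ring.
Qed.

Lemma dmx_ddetM m n :
  dmx_ddet (dmx_mul m n) = dmx_det m * dmx_ddet n + dmx_ddet m * dmx_det n.
Proof.
case: m n => ? ? ? ? ? ? ? ? [? ? ? ? ? ? ? ?].
by rewrite /dmx_ddet /dmx_det /=; ring.
Qed.

Definition dmx_encode (m : dmx) :=
  (e11 m, e12 m, e21 m, e22 m, (d11 m, d12 m, d21 m, d22 m)).
Definition dmx_decode (t : int * int * int * int * (int * int * int * int)) :=
  let: (a, b, c, d, (a', b', c', d')) := t in DMx a b c d a' b' c' d'.
Lemma dmx_encodeK : cancel dmx_encode dmx_decode. Proof. by case. Qed.
HB.instance Definition _ := Choice.copy dmx (can_type dmx_encodeK).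

Definition in_dsl2 (m : dmx) := (dmx_det m == 1) && (dmx_ddet m == 0).
Record dsl2 := DSL2 { dsl2_val :> dmx; _ : in_dsl2 dsl2_val }.
HB.instance Definition _ := [isSub for dsl2_val].
HB.instance Definition _ := [Choice of dsl2 by <:].

Lemma dsl2_det (g : dsl2) : dmx_det g = 1.
Proof. by have /andP[/eqP] := valP g. Qed.
Lemma dsl2_ddet (g : dsl2) : dmx_ddet g = 0.
Proof. by have /andP[_ /eqP] := valP g. Qed.

Lemma dsl2_mul_subproof (g h : dsl2) : in_dsl2 (dmx_mul g h).
Proof.
apply/andP.
by rewrite dmx_ddetM dmx_detM !dsl2_det !dsl2_ddet mulr1 mulr0 mul0r addr0.
Qed.

Lemma dsl2_inv_subproof (g : dsl2) : in_dsl2 (dmx_adj g).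
Proof.
have := dsl2_ddet g; have := dsl2_det g; rewrite /in_dsl2.
case: (dsl2_val g) => a b c d a' b' c' d'.
rewrite /dmx_det /dmx_ddet /= => h1 h0.
by apply/andP; split; apply/eqP; [rewrite -h1 | rewrite -h0]; ring.
Qed.

Definition dsl2_one : dsl2 := @DSL2 dmx_one isT.
Definition dsl2_mul (g h : dsl2) := DSL2 (dsl2_mul_subproof g h).
Definition dsl2_inv (g : dsl2) := DSL2 (dsl2_inv_subproof g).

Lemma dsl2_mulA : associative dsl2_mul.
Proof. by move=> g h k; apply: val_inj; apply: dmx_mulA. Qed.
Lemma dsl2_mul1 : left_id dsl2_one dsl2_mul.
Proof. by move=> g; apply: val_inj; apply: dmx_mul1. Qed.
Lemma dsl2_mulr1 : right_id dsl2_one dsl2_mul.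
Proof. by move=> g; apply: val_inj; apply: dmx_mulr1. Qed.
Lemma dsl2_mulV : left_inverse dsl2_one dsl2_inv dsl2_mul.
Proof.
move=> g; apply: val_inj; have h1 := dsl2_det g; have h0 := dsl2_ddet g.
case: g h1 h0 => -[a b c d a' b' c' d'] /= _.
rewrite /dmx_det /dmx_ddet /= => h1 h0.
by congr DMx; first [ring | rewrite -h1; ring | rewrite -h0; ring].
Qed.
Lemma dsl2_mulrV : right_inverse dsl2_one dsl2_inv dsl2_mul.
Proof.
move=> g; apply: val_inj; have h1 := dsl2_det g; have h0 := dsl2_ddet g.
case: g h1 h0 => -[a b c d a' b' c' d'] /= _.
rewrite /dmx_det /dmx_ddet /= => h1 h0.
by congr DMx; first [ring | rewrite -h1; ring | rewrite -h0; ring].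
Qed.
HB.instance Definition _ := isGroup.Build dsl2
  dsl2_mulA dsl2_mul1 dsl2_mulr1 dsl2_mulV dsl2_mulrV.

Lemma dsl2_dtrC (g h : dsl2) : dmx_dtr (g * h)%g = dmx_dtr (h * g)%g.
Proof. exact: dmx_dtrC. Qed.

(** * Positive words and the eps part of the trace *)

(** The bounds of 1 on [e11], [e22] and [d11] survive multiplication and force [dmx_dtr] to be at
    least 1; [d22] may vanish, as it does for S U. *)
Definition dmx_pos (m : dmx) : bool :=
  [&& 1 <= e11 m, 0 <= e12 m, 0 <= e21 m & 1 <= e22 m] &&
  [&& 1 <= d11 m, 0 <= d12 m, 0 <= d21 m & 0 <= d22 m].

Definition dmx_spos (m : dmx) : bool := dmx_pos m || dmx_pos (dmx_opp m).

Lemma dmx_posM m n : dmx_pos m -> dmx_pos n -> dmx_pos (dmx_mul m n).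
Proof.
case: m n => a b c d a' b' c' d' [p q r s p' q' r' s'].
move=> /andP[/and4P[/= ? ? ? ?] /and4P[/= ? ? ? ?]].
move=> /andP[/and4P[/= ? ? ? ?] /and4P[/= ? ? ? ?]].
by apply/andP; split; apply/and4P; split=> /=; nia.
Qed.

Lemma dmx_oppM m n : dmx_opp (dmx_mul m n) = dmx_mul (dmx_opp m) n.
Proof.
by case: m n => ? ? ? ? ? ? ? ? [? ? ? ? ? ? ? ?]; congr DMx => /=; ring.
Qed.

Lemma dmx_mulNN m n : dmx_mul (dmx_opp m) (dmx_opp n) = dmx_mul m n.
Proof.
by case: m n => ? ? ? ? ? ? ? ? [? ? ? ? ? ? ? ?]; congr DMx => /=; ring.
Qed.

Lemma dmx_oppMr m n : dmx_opp (dmx_mul m n) = dmx_mul m (dmx_opp n).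
Proof.
by case: m n => ? ? ? ? ? ? ? ? [? ? ? ? ? ? ? ?]; congr DMx => /=; ring.
Qed.

Lemma dmx_sposM m n : dmx_spos m -> dmx_spos n -> dmx_spos (dmx_mul m n).
Proof.
rewrite /dmx_spos => /orP[Hm|Hm] /orP[Hn|Hn]; apply/orP.
- by left; apply: dmx_posM.
- by right; rewrite dmx_oppMr; apply: dmx_posM.
- by right; rewrite dmx_oppM; apply: dmx_posM.
- by left; rewrite -dmx_mulNN; apply: dmx_posM.
Qed.

Lemma dmx_spos_dtr m : dmx_spos m -> dmx_dtr m != 0.
Proof.
case: m => a b c d a' b' c' d'; rewrite /dmx_dtr /=.
by case/orP => /andP[_ /and4P[/= ? ? ? ?]]; apply/eqP; lia.
Qed.

(* The generators are - S U S U^-1 and - S U^-1 S U. *)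
Definition gen (t : bool) : dsl2 :=
  if t then @DSL2 (DMx 2 1 1 1 4 2 2 0) isT
  else @DSL2 (DMx 1 1 1 2 2 3 3 2) isT.

(* The frames of a, b, a^-1, b^-1 are S U, S U^-1, U, U^-1: they are chosen so
   that F_x^-1 x F_y is a nonempty positive word in S U and S U^-1 unless x y
   cancels, which turns a product along a reduced word into a product of such
   words. *)
Definition frame (x : letter bool) : dsl2 :=
  match x with
  | (true, true) => @DSL2 (DMx 1 1 0 1 1 1 1 0) isT
  | (false, true) => @DSL2 (DMx (-1) 0 (-1) (-1) (-1) (-1) (-1) 0) isT
  | (true, false) => @DSL2 (DMx 0 1 (-1) (-1) 1 0 (-1) (-1)) isT
  | (false, false) => @DSL2 (DMx (-1) (-1) 1 0 (-1) 0 1 1) isT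
  end.

Lemma frame_spos x y : y != letter_inv x ->
  dmx_spos ((frame x)^-1 * letter_val gen x * frame y)%g.
Proof. by case: x y => [[] []] [[] []] // _; vm_compute. Qed.

Definition word_val (w : seq (letter bool)) : dsl2 :=
  (\big[*%g/1%g]_(x <- w) letter_val gen x)%g.

(** Inserting F F^-1 between consecutive letters, with F the frame of the second, splits the product
    into factors covered by [frame_spos]. *)
Lemma chain_spos x w y : reduced (x :: w) -> y != letter_inv (last x w) ->
  dmx_spos ((frame x)^-1 * word_val (x :: w) * frame y)%g.
Proof.
elim: w x => [|x' w IHw] x.
  by rewrite /word_val big_seq1 => _; apply: frame_spos.
move=> /andP[ne Hw] Hy; rewrite /word_val big_cons -/(word_val _).
rewrite [X in dmx_spos (dsl2_val X)](_ : _ =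
  ((frame x)^-1 * letter_val gen x * frame x') *
  ((frame x')^-1 * word_val (x' :: w) * frame y))%g;
  last by rewrite !mulgA mulgK.
by apply: dmx_sposM; [apply: frame_spos | apply: IHw].
Qed.

Lemma word_dtr_neq0 w : reduced w -> w != [::] -> dmx_dtr (word_val w) != 0.
Proof.
have [n] := ubnP (size w); elim: n w => // n IHn [//|x w] ltn Hw _.
have [Ex|ne] := eqVneq x (letter_inv (last x w)); last first.
  (* A cyclically reduced word: the chain with [y := x] is a conjugate of its value. *)
  by have := dmx_spos_dtr (chain_spos Hw ne); rewrite dsl2_dtrC mulVKg.
have neV (y : letter bool) : letter_inv y != y.
  by case: y => t []; rewrite /letter_inv xpair_eqE andbF.
(* Otherwise the first letter is inverse to the last; removing both conjugates the value, so
   [dmx_dtr] is kept and the word gets shorter. *)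
case/lastP: w => [|w z] in ltn Hw Ex *.
  by have := neV x; rewrite -Ex eqxx.
rewrite last_rcons in Ex.
have Hw' : reduced w.
  by move: Hw; rewrite /reduced -cats1 -cat1s => /cat_sorted2[_ /cat_sorted2[]].
have wn0 : w != [::].
  by case: w Hw {ltn Hw'} => //; rewrite /reduced /= Ex letter_invK eqxx.
have -> : word_val (x :: rcons w z) =
    ((letter_val gen z)^-1 * (word_val w * letter_val gen z))%g.
  by rewrite /word_val big_cons big_rcons Ex letter_valV.
rewrite dsl2_dtrC -mulgA mulgV mulg1.
by apply: IHn => //; move: ltn; rewrite /= size_rcons ltnS => /ltnW.
Qed.

Lemma lift_dtr_neq0 (g : free_group bool) :
  g != 1%g -> dmx_dtr (fg_lift gen g) != 0.
Proof. by move=> g1; apply: word_dtr_neq0; [exact: fg_reduced | exact: g1]. Qed.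

(** * The adjoint cocycle *)

Definition mx_of_rows (m n : nat) (rows : seq (seq int)) : 'M[int]_(m, n) :=
  \matrix_(i < m, j < n) nth 0 (nth [::] rows i) j.

(* Coordinates (x, y, z) on sl_2 stand for [[x, y], [z, -x]].  For M + eps N in
   SL_2(Z[eps]), [ad_mx] is X |-> M X M^-1, [cocycle] is N M^-1 and
   [trace_form] is X |-> tr (M X). *)
Definition ad_mx (m : dmx) : 'M[int]_3 :=
  let: DMx a b c d _ _ _ _ := m in
  mx_of_rows 3 3 [:: [:: a * d + b * c; - (a * c); b * d];
                     [:: - (a * b) *+ 2; a * a; - (b * b)];
                     [:: (c * d) *+ 2; - (c * c); d * d]].

Definition cocycle (m : dmx) : 'cV[int]_3 :=
  let: DMx a b c d a' b' c' d' := m in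
  mx_of_rows 3 1 [:: [:: a' * d - b' * c]; [:: b' * a - a' * b];
                     [:: c' * d - d' * c]].

Definition trace_form (m : dmx) : 'rV[int]_3 :=
  mx_of_rows 1 3 [:: [:: e11 m - e22 m; e21 m; e12 m]].

Ltac mx3_entries :=
  apply/matrixP => -[[|[|[|i]]] Hi] [[|[|[|j]]] Hj] //;
  rewrite ?(mxE, big_ord_recl, big_ord0) /=.

Lemma ad_mxM m n : ad_mx (dmx_mul m n) = ad_mx m *m ad_mx n.
Proof.
by case: m n => ? ? ? ? ? ? ? ? [? ? ? ? ? ? ? ?]; mx3_entries; ring.
Qed.

Lemma ad_mx1 : ad_mx dmx_one = 1%:M.
Proof. by mx3_entries. Qed.

Lemma cocycle1 : cocycle dmx_one = 0.
Proof. by mx3_entries. Qed.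

(** For M + eps N and P + eps Q, (N P + M Q) adj(M P) = det P N adj M + M (Q adj P) adj M. Since tr
    (Q adj P) is [dmx_ddet n], three coordinates determine Q adj P; the correction vector below
    holds the coordinates of M E22 adj M. *)
Lemma cocycleM m n : dmx_ddet n = 0 ->
  cocycle (dmx_mul m n) = dmx_det n *: cocycle m + ad_mx m *m cocycle n.
Proof.
case: m n => a b c d a' b' c' d' [p q r s p' q' r' s'] h0.
(* The two sides differ by a multiple of [dmx_ddet n]. *)
rewrite -[RHS]addr0 -(scale0r (mx_of_rows 3 1 [:: [:: - (b * c)]; [:: a * b];
  [:: - (c * d)]])) -h0.
by mx3_entries; rewrite /dmx_det /dmx_ddet /=; ring.
Qed.

(** By cyclicity, tr (M M X adj M) = det M tr (M X). *)
Lemma trace_form_ad m : trace_form m *m ad_mx m = dmx_det m *: trace_form m.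
Proof.
by case: m => ? ? ? ? ? ? ? ?; mx3_entries; rewrite /dmx_det /=; ring.
Qed.

Lemma trace_form_cocycle m : dmx_ddet m = 0 ->
  trace_form m *m cocycle m = (dmx_det m * dmx_dtr m)%:M.
Proof.
(* The coordinates of N adj M drop a multiple [dmx_ddet m] of E22, and tr (M E22) = [d]. *)
case: m => a b c d a' b' c' d' h0; rewrite -[LHS]addr0 -(scale0r (d%:M)) -h0.
by mx3_entries; rewrite !mulr1n /dmx_dtr /dmx_det /dmx_ddet /=; ring.
Qed.

(** * Affine maps of the torus *)

Section TorusAffine.
Variables (R : realType) (Lambda : zmodClosed (CC R)) (n : nat).
Implicit Types (A B : 'M[int]_n) (t z w : 'cV[CC R]_n) (p : torus Lambda n).

Definition intmx m k (A : 'M[int]_(m, k)) : 'M[CC R]_(m, k) := map_mx intr A.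

Lemma torus_projP z w :
  torus_proj Lambda z = torus_proj Lambda w <-> lattice_pow Lambda n (z - w).
Proof.
split=> [/matrixP E i | H].
  by have := E i 0; rewrite !mxE => /eqP; rewrite -Quotient.idealrBE.
apply/matrixP => i j; rewrite ord1 !mxE; apply/eqP.
by have := H i; rewrite !mxE Quotient.idealrBE.
Qed.

Lemma torus_proj_surj p : exists z, torus_proj Lambda z = p.
Proof.
exists (map_mx repr p); apply/matrixP => i j.
by rewrite !mxE reprK.
Qed.

(** Integer entries let one linear part serve every lattice: [Lambda] is stable under integer
    multiples and sums. *)
Lemma intmx_lattice m (A : 'M[int]_(m, n)) z i :
  lattice_pow Lambda n z -> (intmx A *m z) i 0 \in Lambda.
Proof.
move=> zL; rewrite mxE; apply: rpred_sum => j _.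
by rewrite mxE mulrzl rpredMz.
Qed.

Definition torus_affine A t p : torus Lambda n :=
  torus_proj Lambda (intmx A *m map_mx repr p + t).

Lemma torus_affine_proj A t z :
  torus_affine A t (torus_proj Lambda z) = torus_proj Lambda (intmx A *m z + t).
Proof.
apply/torus_projP => i; rewrite opprD addrACA subrr addr0 -mulmxBr.
apply: intmx_lattice.
by apply/torus_projP; apply/matrixP => k j; rewrite !mxE reprK.
Qed.

Lemma torus_affine_comp A B s t p :
  torus_affine A s (torus_affine B t p) =
  torus_affine (A *m B) (intmx A *m t + s) p.
Proof.
have [z <-] := torus_proj_surj p; rewrite !torus_affine_proj.
by rewrite mulmxDr mulmxA /intmx map_mxM addrA.
Qed.

Lemma torus_affine1 p : torus_affine 1%:M 0 p = p.
Proof.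
have [z <-] := torus_proj_surj p.
by rewrite torus_affine_proj /intmx map_mx1 mul1mx addr0.
Qed.

Lemma affine_differentiable m (L : 'M[CC R]_(m, n)) (t : 'cV[CC R]_m) z :
  differentiable (fun w : 'cV[CC R]_n => L *m w + t) z.
Proof.
(* Expanding along the columns of [L] reduces the claim to coordinate functions. *)
have -> : (fun w => L *m w + t) =
    (\sum_(j < n) (fun w : 'cV[CC R]_n => w j 0 *: col j L)) + cst t.
  apply/funext => w; rewrite fctE /=; congr (_ + _).
  rewrite fct_sumE; apply/matrixP => i j; rewrite ord1 mxE summxE.
  by apply: eq_bigr => k _; rewrite !mxE mulrC.
apply: differentiableD => //; apply: differentiable_sum => j.
by apply: differentiableZl; apply: differentiable_coord.
Qed.

Lemma torus_affine_holomorphic A t : torus_holomorphic (torus_affine A t).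
Proof.
move=> z; exists (fun w => intmx A *m w + t).
apply: (@filterE _ (nbhs z)) => w; split.
  exact: torus_affine_proj.
exact: affine_differentiable.
Qed.

Lemma torus_affine_hol_transformation A B t : A *m B = 1%:M -> B *m A = 1%:M ->
  hol_affine_transformation (torus_affine A t).
Proof.
move=> AB BA; split.
  split; first exact: torus_affine_holomorphic.
  exists (torus_affine B (- (intmx B *m t))); split=> [p|p|].
  - by rewrite torus_affine_comp BA subrr torus_affine1.
  - rewrite torus_affine_comp AB mulmxN mulmxA -map_mxM AB map_mx1 mul1mx.
    by rewrite addNr torus_affine1.
  - exact: torus_affine_holomorphic.
have intAB : intmx A *m intmx B = 1%:M by rewrite -map_mxM AB map_mx1.
exists (intmx A), t; split; last exact: torus_affine_proj.
  by have [] := mulmx1_unit intAB.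
apply/seteqP; split=> [_ [z zL <-] i|z zL]; first exact: intmx_lattice.
exists (intmx B *m z); first by move=> i; exact: intmx_lattice.
by rewrite mulmxA intAB mul1mx.
Qed.

End TorusAffine.

(** * A number of infinite order modulo the lattice *)

Lemma discrete_gap (R : realType) (Lambda : zmodClosed (CC R)) :
  [set` Lambda] `<=` isolated [set` Lambda] ->
  exists2 e : R, 0 < e &
    forall x : R, (x%:C)%C \in Lambda -> `|x| < e -> x = 0.
Proof.
move=> /(_ 0 (rpred0 _)) [_ [V /nbhs_ballP[e /= e0 eV] VL]].
(* The radius [e] is a complex number; its positivity makes it real. *)
move: e0; rewrite ltcE /= => /andP[/eqP Ime Re0].
exists (complex.Re e) => // x xL xe.
suff : [set 0 : CC R] (x%:C)%C by move=> /(congr1 (@complex.Re R)).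
rewrite -VL; split=> //; apply: eV; rewrite -ball_normE /= sub0r normrN.
by rewrite normc_def /= expr0n addr0 sqrtr_sqr ltcE /= Ime eqxx.
Qed.

Lemma discrete_nontorsion (R : realType) (Lambda : zmodClosed (CC R)) :
  [set` Lambda] `<=` isolated [set` Lambda] ->
  exists tau : CC R, forall k : int, k != 0 -> tau *~ k \notin Lambda.
Proof.
move=> /discrete_gap[e e0 gap]; pose s : R := Num.sqrt 2.
have ss : s * s = 2 by rewrite -expr2 sqr_sqrtr.
have s0 : 0 <= s := sqrtr_ge0 _.
apply: contrapT => /forallNP notau.
have tors (x : R) : exists2 k : int, k != 0 & ((x *~ k)%:C)%C \in Lambda.
  have /existsNP[k /not_implyP[k0 /negP]] := notau (x%:C)%C.
  by rewrite negbK -rmorphMz; exists k.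
have [k k0 kL] := tors 1; have [l l0 lL] := tors s.
pose q := s - 1; pose c : R := (k * l)%:~R.
(* Both c q^i and c q^i s are carried along, because multiplying by q = s - 1 mixes them through s^2
   = 2. *)
have qL i :
    ((c * q ^+ i)%:C)%C \in Lambda /\ ((c * q ^+ i * s)%:C)%C \in Lambda.
  elim: i => [|i [IH1 IH2]].
    rewrite expr0 mulr1; split.
      have -> : c = 1 *~ k *~ l by rewrite -mulrzA.
      by rewrite rmorphMz rpredMz.
    have -> : c * s = s *~ l *~ k by rewrite -mulrzA mulrC mulrzr mulrC.
    by rewrite rmorphMz rpredMz.
  rewrite exprSr; split.
    have -> : c * (q ^+ i * q) = c * q ^+ i * s - c * q ^+ i.
      by rewrite /q; ring.
    by rewrite rmorphB rpredB.
  have -> : c * (q ^+ i * q) * s = c * q ^+ i *+ 2 - c * q ^+ i * s.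
    by rewrite -[_ *+ 2]mulr_natr -ss /q; ring.
  by rewrite rmorphB rmorphMn rpredB ?rpredMn.
have c0 : c != 0 by rewrite intr_eq0 mulf_neq0.
have q0 : 0 < q by rewrite /q; nra.
have q2 : q <= 2^-1 by rewrite /q; nra.
(* As q is at most 1/2, it suffices that 2^i exceeds |c| / e, which this exponent ensures. *)
have /(gap _ (qL _).1)/eqP : `|c * q ^+ (Num.bound (`|c| / e))| < e.
  set i := Num.bound _; rewrite normrM normrX (gtr0_norm q0).
  apply: (@le_lt_trans _ _ (`|c| * 2^-1 ^+ i)).
    by rewrite ler_wpM2l // lerXn2r ?nnegrE ?invr_ge0 // ltW.
  rewrite exprVn ltr_pdivrMr ?exprn_gt0 // mulrC -ltr_pdivrMr //.
  exact: upper_nthrootP.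
by rewrite mulf_eq0 (negbTE c0) expf_eq0 (gt_eqF q0) andbF.
Qed.

(** * The affine action and its fixed points *)

Definition torus_act (R : realType) (Lambda : zmodClosed (CC R)) (tau : CC R)
    (g : dsl2) : torus Lambda 3 -> torus Lambda 3 :=
  torus_affine (ad_mx g) (tau *: intmx R (cocycle g)).
Arguments torus_act {R} Lambda tau g p.

Section TorusAct.
Variables (R : realType) (Lambda : zmodClosed (CC R)) (tau : CC R).

Lemma torus_act_is_action : is_group_action (torus_act Lambda tau).
Proof.
split=> [p|g h p].
  rewrite /torus_act ad_mx1 cocycle1 /intmx map_mx0 scaler0.
  exact: torus_affine1.
rewrite /torus_act torus_affine_comp -ad_mxM.
rewrite cocycleM ?dsl2_ddet // dsl2_det scale1r /intmx map_mxD map_mxM.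
by rewrite scalerDr scalemxAr addrC.
Qed.

Lemma torus_act_affine g : hol_affine_transformation (torus_act Lambda tau g).
Proof.
by apply: (@torus_affine_hol_transformation _ _ _ _ (ad_mx g^-1%g));
  rewrite -ad_mxM -[dmx_mul _ _]/(dsl2_val (_ * _)%g) ?mulgV ?mulVg ad_mx1.
Qed.

Lemma torus_act_fixed g p :
  (forall k : int, k != 0 -> tau *~ k \notin Lambda) ->
  torus_act Lambda tau g p = p -> dmx_dtr g = 0.
Proof.
move=> tauP.
have [z <-] := torus_proj_surj p; rewrite /torus_act torus_affine_proj.
(* Pairing with the form fixed by the linear part cancels [z] and leaves [tau] times [dmx_dtr g] in
   [Lambda]. *)
move=> /torus_projP/(intmx_lattice (trace_form g) 0).
rewrite addrAC mulmxDr mulmxBr mulmxA -map_mxM trace_form_ad dsl2_det scale1r.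
rewrite subrr add0r -scalemxAr -map_mxM trace_form_cocycle ?dsl2_ddet //.
rewrite dsl2_det mul1r !mxE mulr1n mulrzr => tL.
by apply/eqP; apply: contraTT tL => /tauP.
Qed.

End TorusAct.

(** Two positive letters never cancel, so both products are two-letter words, with different first
    letters. *)
Lemma fg_gen_noncommute (T : choiceType) (s t : T) :
  s != t -> ~ commute (fg_gen s) (fg_gen t).
Proof.
move=> st /(congr1 (@fg_word T)) /=.
by rewrite !xpair_eqE !andbF => -[Est]; rewrite Est eqxx in st.
Qed.

Theorem theorem2p3 (R : realType) (Lambda0 : zmodClosed (CC R))
    (hLambda0 : cocompact_lattice Lambda0) :
  exists (G : groupType) (act : G -> torus Lambda0 3 -> torus Lambda0 3),
    is_free_group G
    /\ (exists g h : G, ~ commute g h)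
    /\ is_group_action act
    /\ (forall g : G, hol_affine_transformation (act g))
    /\ is_free_action act.
Proof.
have [tau tauP] := discrete_nontorsion hLambda0.1.
have [lift1 liftM] := fg_lift_morphism gen.
have [act1 actM] := torus_act_is_action Lambda0 tau.
exists (free_group bool), (fun g => torus_act Lambda0 tau (fg_lift gen g)).
split; first exact: free_group_is_free.
split; first by exists (fg_gen true), (fg_gen false); exact: fg_gen_noncommute.
split; first by split=> [p|g h p]; rewrite ?lift1 ?act1 ?liftM ?actM.
split=> [g|p g]; first exact: torus_act_affine.
move=> /(torus_act_fixed tauP) tr0.
by apply/eqP; apply: contra_eqT tr0; apply: lift_dtr_neq0.
Qed.
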